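(* For every pattern $P$ and every sufficiently large (depending on $P$) fixed integer $m_0$, we have $\operatorname{ssat}(m_0,n,P)=O(1)$ (as $n\to\infty$) if and only if the top row and the bottom row of $P$ each contain a $1$ entry which is the only $1$ entry in its column.
   Context: All matrices are 0-1 matrices; a pattern is a 0-1 matrix. A matrix $M$ contains $P$ if some submatrix of $M$ (obtained by deleting rows and columns) can be turned into $P$ by changing some number (possibly zero) of its ones to zeroes; such an occurrence is called a copy of $P$ in $M$. The weight of a matrix is its number of $1$ entries. A matrix $M$ is semisaturating for $P$ if changing any $0$ entry of $M$ to a $1$ introduces a new copy of $P$, i.e. a copy of $P$ in which the changed entry plays the role of a $1$ entry of $P$ ($M$ itself is allowed to contain $P$). $\operatorname{ssat}(m,n,P)$ is the minimum weight of an $m\times n$ matrix that is semisaturating for $P$. Asymptotic notation is for $n\to\infty$ with $P$ and $m_0$ fixed. *)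

(* Defs.v *)
From HB Require Import structures.
From mathcomp Require Import all_boot all_order all_algebra.

Set Implicit Arguments.
Unset Strict Implicit.
Unset Printing Implicit Defensive.

(* 0-1 matrices, patterns included, are boolean matrices; row 0 is the top. *)

Definition weight m n (M : 'M[bool]_(m, n)) : nat :=
  #|[set ij : 'I_m * 'I_n | M ij.1 ij.2]|.

Definition increasing k m (f : {ffun 'I_k -> 'I_m}) : bool :=
  [forall i : 'I_k, forall j : 'I_k, (i < j) ==> (f i < f j)].

(* The submatrix of M on the rows f 0 < f 1 < ... and the columns
   g 0 < g 1 < ... becomes P after changing some of its ones to zeroes. *)
Definition copy k l m n (P : 'M[bool]_(k, l)) (M : 'M[bool]_(m, n))
    (f : {ffun 'I_k -> 'I_m}) (g : {ffun 'I_l -> 'I_n}) : bool :=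
  [&& increasing f, increasing g &
      [forall a, forall b, P a b ==> mxsub f g M a b]].

Definition set_one m n (M : 'M[bool]_(m, n)) (i0 : 'I_m) (j0 : 'I_n) :
    'M[bool]_(m, n) :=
  \matrix_(i, j) (((i == i0) && (j == j0)) || M i j).

Definition semisaturating k l m n (P : 'M[bool]_(k, l)) (M : 'M[bool]_(m, n)) :
    bool :=
  [forall i0, forall j0, ~~ M i0 j0 ==>
    [exists f : {ffun 'I_k -> 'I_m}, exists g : {ffun 'I_l -> 'I_n},
      copy P (set_one M i0 j0) f g &&
      [exists a, exists b, [&& P a b, f a == i0 & g b == j0]]]].

Lemma semisaturating_ones k l m n (P : 'M[bool]_(k, l)) :
  semisaturating P (const_mx true : 'M[bool]_(m, n)).
Proof. by apply/forallP => i; apply/forallP => j; rewrite mxE. Qed.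

(* By semisaturating_ones the default value of this arg min is admissible. *)
Definition ssat m n k l (P : 'M[bool]_(k, l)) : nat :=
  weight [arg min_(M < (const_mx true : 'M[bool]_(m, n))
                     | semisaturating P M) weight M].

Lemma ssat_attained m n k l (P : 'M[bool]_(k, l)) :
  exists2 M : 'M[bool]_(m, n), semisaturating P M & weight M = ssat m n P.
Proof.
rewrite /ssat; case: arg_minnP => [|M hM _]; first exact: semisaturating_ones.
by exists M.
Qed.

Lemma ssat_le m n k l (P : 'M[bool]_(k, l)) (M : 'M[bool]_(m, n)) :
  semisaturating P M -> ssat m n P <= weight M.
Proof.
rewrite /ssat; case: arg_minnP => [|N _ minN]; first exact: semisaturating_ones.
exact: minN.
Qed.

Definition only_one_in_column k l (P : 'M[bool]_(k, l)) (i : 'I_k) (j : 'I_l) :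
    Prop :=
  P i j /\ forall i' : 'I_k, P i' j -> i' = i.

Definition bounded_at_infinity (u : nat -> nat) : Prop :=
  exists C n0 : nat, forall n : nat, n0 <= n -> u n <= C.

(* Main.v *)
Require Import Defs.
From HB Require Import structures.
From mathcomp Require Import all_boot all_order all_algebra.
From mathcomp Require Import zify.

Set Implicit Arguments.
Unset Strict Implicit.
Unset Printing Implicit Defensive.

(** Both directions come down to the fate of an empty column.

If semisaturating [m0 * n] matrices of bounded weight exist for arbitrarily
large [n], then some of them have an empty column.  A copy of [P] that uses a
new one at [(i0, j0)], with column [j0] empty, has no other one of [P] in the
column it sends to [j0]; so the one of [P] that lands on [(i0, j0)] is alone in
its column ([new_copy_in_empty_column]).  For [i0] the top row, only the top
row of [P] can be sent to [i0], and likewise at the bottom.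

Conversely, let [P a b] be alone in its column.  Fill with ones the first and
the last [l] columns, where [P] has [l.+1] columns, and leave the rest empty.  A
new one in an empty column [j0] can then play [P a b]: the other columns of [P]
find room among the full ones on either side, and column [b] asks for nothing
but the new one.  The rows are no obstacle as long as there are [a] rows above
the new one and [k - a] below, where [P] has [k.+1] rows
([frame_copy]).  When [m0] is at least [2 * k], each row has [k] rows
below it or [k] rows above it, so [a] can be taken to be the top or the bottom
row.  The weight of this matrix is bounded in terms of [m0] and [l] alone. *)

Lemma increasing_ltn k m (f : {ffun 'I_k -> 'I_m}) (i j : 'I_k) :
  increasing f -> i < j -> f i < f j.
Proof. by move=> /forallP /(_ i) /forallP /(_ j) /implyP; apply. Qed.

Lemma increasing_inj k m (f : {ffun 'I_k -> 'I_m}) :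
  increasing f -> injective f.
Proof.
move=> finc i j fij; apply: val_inj => /=.
case: (ltngtP i j) => // /(increasing_ltn finc); by rewrite fij ltnn.
Qed.

Lemma empty_column m n (M : 'M[bool]_(m, n)) :
  weight M < n -> exists j, forall i, ~~ M i j.
Proof.
move=> Mltn.
case: (boolP [exists j, forall i, ~~ M i j]) => [/existsP [j /forallP Mj]|].
  by exists j.
rewrite negb_exists => /forallP Mcol; exfalso; move: Mltn.
rewrite ltnNge -{1}(card_ord n) -cardsT => /negP; apply.
set S := [set ij : 'I_m * 'I_n | M ij.1 ij.2].
apply: leq_trans (leq_imset_card (@snd 'I_m 'I_n) S).
apply/subset_leq_card/subsetP => j _.
move: (Mcol j); rewrite negb_forall => /existsP [i]; rewrite negbK => Mij.
by apply/imsetP; exists (i, j); rewrite ?inE.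
Qed.

(** A second one of [P] in column [b] would be sent to column [j0], whose only
one is the new one; as [f] is injective, it would be the same one of [P]. *)
Lemma new_copy_in_empty_column k l m n (P : 'M[bool]_(k, l))
    (M : 'M[bool]_(m, n)) (i0 : 'I_m) (j0 : 'I_n) :
  semisaturating P M -> (forall i, ~~ M i j0) ->
  exists (f : {ffun 'I_k -> 'I_m}) (a : 'I_k) (b : 'I_l),
    [/\ increasing f, f a = i0 & only_one_in_column P a b].
Proof.
move=> /forallP /(_ i0) /forallP /(_ j0) /implyP /(_ _) Msat Mj0.
have /existsP [f /existsP [g]] := Msat (Mj0 i0).
case/andP=> /and3P [finc _ /forallP PM].
case/existsP=> a /existsP [b /and3P [Pab /eqP fa /eqP gb]].
exists f, a, b; split=> //; split=> // a' Pa'b.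
move: (PM a') => /forallP /(_ b); rewrite Pa'b !mxE gb (negbTE (Mj0 _)) orbF.
by case/andP=> /eqP fa' _; apply: (increasing_inj finc); rewrite fa fa'.
Qed.

(** As [i0] is arbitrary, an extreme row can be chosen for it, and [f] being
increasing then forces [a] to be extreme too. *)
Lemma bounded_ssat_only_one k l m (P : 'M[bool]_(k, l)) (i0 : 'I_m) :
  bounded_at_infinity (fun n => ssat m n P) ->
  exists (f : {ffun 'I_k -> 'I_m}) (a : 'I_k) (b : 'I_l),
    [/\ increasing f, f a = i0 & only_one_in_column P a b].
Proof.
case=> C [n0 leC].
have [M Msat Mw] := ssat_attained m (maxn n0 C.+1) P.
have [|j0 Mj0] := @empty_column _ _ M.
  by rewrite Mw; apply: leq_ltn_trans (leC _ (leq_maxl _ _)) (leq_maxr _ _).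
exact: new_copy_in_empty_column Msat Mj0.
Qed.

Definition frame m n l : 'M[bool]_(m, n) :=
  \matrix_(i < m, j < n) ((j < l) || (n - l <= j)).

Lemma weight_frame m n l : weight (frame m n l) <= m * (l + l).+1.
Proof.
(* Full columns are numbered without gaps: from the left edge those on the
   left, and then from the right edge the others. *)
pose squeeze (ij : 'I_m * 'I_n) : 'I_m * 'I_(l + l).+1 :=
  (ij.1, inord (if ij.2 < l then ij.2 : nat else l + (n.-1 - ij.2))).
rewrite /weight -(card_in_imset (f := squeeze)); last first.
  move=> [i j] [i' j']; rewrite !inE !mxE /squeeze /= => Fj Fj'.
  case=> -> /(congr1 val) /=.
  have jn := ltn_ord j; have j'n := ltn_ord j'.
  rewrite !inordK => [E||]; try by case: ifP => ?; lia.
  congr pair; apply: val_inj => /=; move: E.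
  by case: ifP => ?; case: ifP => ?; lia.
rewrite -[X in _ <= X * _](card_ord m) -[X in _ <= _ * X]card_ord -card_prod.
exact: max_card.
Qed.

(** Since [P a b] is alone in its column, the copy needs ones in the full
columns only, apart from the new one.  The two hypotheses on [i0] say that
there are at least [a] rows above [i0] and [k - a] below. *)
Lemma frame_copy k l m n (P : 'M[bool]_(k.+1, l.+1))
    (a : 'I_k.+1) (b : 'I_l.+1) (i0 : 'I_m) (j0 : 'I_n) :
  only_one_in_column P a b -> a <= i0 -> i0 + k < m + a ->
  ~~ frame m n l i0 j0 ->
  [exists f : {ffun 'I_k.+1 -> 'I_m}, exists g : {ffun 'I_l.+1 -> 'I_n},
     copy P (set_one (frame m n l) i0 j0) f g &&
     [exists a, exists b, [&& P a b, f a == i0 & g b == j0]]].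
Proof.
case=> Pab Pb ai0 i0m; rewrite mxE negb_or -leqNgt -ltnNge => /andP [lj0 j0n].
(* Rows are consecutive, with row a at i0; column b goes to j0, the columns on
   its left to the leftmost ones and those on its right to the rightmost. *)
pose f : {ffun 'I_k.+1 -> 'I_m} := [ffun r : 'I_k.+1 => insubd i0 (i0 + r - a)].
pose g : {ffun 'I_l.+1 -> 'I_n} := [ffun c : 'I_l.+1 => insubd j0
  (if c < b then c : nat else if c == b then j0 : nat else n - l.+1 + c)].
have fE r : f r = i0 + r - a :> nat.
  have := ltn_ord r; rewrite ffunE val_insubd => rk.
  by rewrite ifT //; lia.
have gE c : g c = (if c < b then c : nat else if c == b then j0 : nat
                   else n - l.+1 + c) :> nat.
  have := ltn_ord c; have := ltn_ord b; have := ltn_ord j0.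
  rewrite ffunE val_insubd => jn bl cl.
  rewrite ifT //; case: ifP => // _; first lia.
  by case: ifP => // _; lia.
apply/existsP; exists f; apply/existsP; exists g; apply/andP; split; last first.
  apply/existsP; exists a; apply/existsP; exists b; rewrite Pab -!val_eqE /=.
  by rewrite fE gE ltnn eqxx addnK !eqxx.
apply/and3P; split.
- apply/forallP => r; apply/forallP => r'; apply/implyP => rr'.
  by rewrite !fE; lia.
- apply/forallP => c; apply/forallP => c'; apply/implyP => cc'.
  have := ltn_ord c'; have := ltn_ord b; rewrite !gE -!val_eqE /= => bl c'l.
  by case: (ltngtP c b) => ?; case: (ltngtP c' b) => ?; lia.
apply/forallP => r; apply/forallP => c; apply/implyP => Prc; rewrite !mxE.
case: (eqVneq c b) Prc => [-> /Pb -> | cb _].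
  by rewrite -!val_eqE /= fE gE ltnn eqxx addnK !eqxx.
apply/orP; right; rewrite gE (negbTE cb); move: cb; rewrite -val_eqE /= => cb.
have := ltn_ord c; have := ltn_ord b.
by case: (ltnP c b) => ?; lia.
Qed.

Lemma semisaturating_frame k l m n (P : 'M[bool]_(k.+1, l.+1))
    (bt bb : 'I_l.+1) :
  only_one_in_column P ord0 bt -> only_one_in_column P ord_max bb ->
  k.*2 <= m -> semisaturating P (frame m n l).
Proof.
move=> Pbt Pbb km; apply/forallP => i0; apply/forallP => j0; apply/implyP => Fij.
case: (leqP k i0) => ki0.
  by apply: frame_copy Pbb _ _ Fij => //=; rewrite ltn_add2r.
by apply: frame_copy Pbt _ _ Fij => //=; lia.
Qed.

Theorem proposition3p1 (k l : nat) (P : 'M[bool]_(k.+1, l.+1)) :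
  exists M0 : nat, forall m0 : nat, M0 <= m0 ->
    (bounded_at_infinity (fun n => ssat m0 n P) <->
     (exists j : 'I_l.+1, only_one_in_column P ord0 j) /\
     (exists j : 'I_l.+1, only_one_in_column P ord_max j)).
Proof.
(* One more than 2k, so that the matrices have a row even if k = 0. *)
exists k.*2.+1 => -[//|m] km; split=> [bnd | [[bt Pbt] [bb Pbb]]]; last first.
  exists (m.+1 * (l + l).+1), 0 => n _; apply: leq_trans (weight_frame _ n _).
  by apply: ssat_le; apply: semisaturating_frame Pbt Pbb _; apply: ltnW.
split.
- have [f [a [b [finc fa Pab]]]] := bounded_ssat_only_one (@ord0 m) bnd.
  exists b; suff <- : a = ord0 by [].
  apply: val_inj; apply/eqP; rewrite eqn0Ngt; apply/negP => a_gt0.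
  by have := @increasing_ltn _ _ f ord0 a finc a_gt0; rewrite fa.
- have [f [a [b [finc fa Pab]]]] := bounded_ssat_only_one (@ord_max m) bnd.
  exists b; suff <- : a = ord_max by [].
  apply: val_inj; apply/eqP; rewrite eqn_leq -ltnS ltn_ord leqNgt /=.
  apply/negP => a_lt; have := @increasing_ltn _ _ f a ord_max finc a_lt.
  by rewrite fa ltnNge -ltnS ltn_ord.
Qed.
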